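(* Suppose that $R$ is an integral domain. Then $R$ is a discrete valuation ring (DVR) if and only if $R$ has a unique nonzero maximal ideal and has the property that $I \mid J$ for all ideals $I$ and $J$ of $R$ with $J \subseteq I$.
   Context: All rings are commutative with unity. For ideals $I, J$ of an integral domain, $I \mid J$ ($I$ divides $J$) means that there is an ideal $I'$ such that $I I' = J$. A discrete valuation of a field $K$ is a surjective group homomorphism $v\colon K^\times \to \mathbb{Z}$ (from the multiplicative group of $K$ to the additive group $\mathbb{Z}$) such that $v(x+y)\ge \min\{v(x),v(y)\}$ for all $x,y\in K^\times$ with $x+y\neq 0$; by convention $v(0)=\infty$. A discrete valuation ring (DVR) is any ring of the form $\mathcal{O}_v=\{x\in K \mid v(x)\ge 0\}$, where $K$ is a field and $v$ is a discrete valuation of $K$. ''A unique nonzero maximal ideal'' means that exactly one nonzero maximal ideal exists. *)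

(* Defs.v *)
From mathcomp Require Import all_boot all_order all_algebra.
From mathcomp Require Import boolp classical_sets.

Set Implicit Arguments.
Unset Strict Implicit.
Unset Printing Implicit Defensive.

Import Order.TTheory GRing.Theory Num.Theory.
Local Open Scope classical_set_scope.
Local Open Scope ring_scope.

(* The ideals of mathcomp's ring_quotient are boolean predicates and are
   required to be proper; here an ideal is an arbitrary set, possibly the whole
   ring. *)
Definition is_ideal (R : idomainType) (I : set R) : Prop :=
  [/\ I 0,
      forall x y, I x -> I y -> I (x + y)
    & forall a x, I x -> I (a * x)].

Definition ideal_mul (R : idomainType) (I J : set R) : set R :=
  [set x | exists (n : nat) (a b : 'I_n -> R),
     [/\ forall i, I (a i), forall i, J (b i) & x = \sum_(i < n) a i * b i]].

Definition ideal_dvd (R : idomainType) (I J : set R) : Prop :=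
  exists I' : set R, is_ideal I' /\ ideal_mul I I' = J.

Definition maximal_ideal (R : idomainType) (M : set R) : Prop :=
  [/\ is_ideal M, M <> setT
    & forall I : set R, is_ideal I -> M `<=` I -> I = M \/ I = setT].

(* A homomorphism from the multiplicative group of K to the additive group of
   int is encoded by a total function whose value at 0 is arbitrary: no clause
   below, nor [valuation_ring], depends on [v 0]. *)
Definition discrete_valuation (K : fieldType) (v : K -> int) : Prop :=
  [/\ forall x y, x != 0 -> y != 0 -> v (x * y) = v x + v y,
      forall n : int, exists2 x, x != 0 & v x = n
    & forall x y, x != 0 -> y != 0 -> x + y != 0 ->
        Num.min (v x) (v y) <= v (x + y)].

(* The disjunct [x = 0] implements the convention v(0) = oo. *)
Definition valuation_ring (K : fieldType) (v : K -> int) : set K :=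
  [set x | x = 0 \/ 0 <= v x].

(* [R] is of the form O_v up to isomorphism: an injective ring morphism into K
   with range O_v is an isomorphism of R onto the subring O_v of K. *)
Definition is_DVR (R : idomainType) : Prop :=
  exists (K : fieldType) (v : K -> int) (f : {rmorphism R -> K}),
    [/\ discrete_valuation v, injective f & range f = valuation_ring v].

(* Main.v *)
Require Import Defs.
From mathcomp Require Import all_boot all_order all_algebra.
From mathcomp Require Import boolp classical_sets.
From mathcomp Require Import zify.
Import Order.TTheory GRing.Theory Num.Theory.
Set Implicit Arguments.
Unset Strict Implicit.
Unset Printing Implicit Defensive.
Local Open Scope classical_set_scope.
Local Open Scope ring_scope.

(** Both sides of the equivalence say that [R] has a uniformizer: a nonzero
    nonunit [t] such that every nonzero element of [R] is a unit times a power
    of [t].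

    In a DVR any element of valuation 1 is a uniformizer ([DVR_uniformizer]). A
    uniformizer [t] makes every nonzero ideal principal, generated by the least
    power of [t] in it ([uniformizer_principal]), and makes [(t)] the set of
    nonunits, hence the only nonzero maximal ideal
    ([uniformizer_unique_maximal]). A principal ideal divides every ideal inside
    it ([principal_dvd]), so in this case containment is division.

    Conversely, suppose that containment is division and that [M] is the unique
    nonzero maximal ideal. Krull's theorem ([proper_ideal_sub_maximal]) puts
    every nonunit in [M]. If [a] is a nonzero element of an ideal [I], then
    [I I' = (a)] for some [I'], so [a] is a sum of products [x_i y_i], each a
    multiple [u_i a] of [a]; since the [u_i] sum to 1, one of them is a unit,
    and the corresponding [x_i] generates [I] ([local_dvd_principal]). Thus all
    ideals are principal; in particular [M = (t)]. The intersection of the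
    [(t ^+ n)], being principal too, vanishes, so dividing a nonzero element by
    [t] as long as possible stops, and what it leaves is a unit
    ([local_pid_uniformizer]). Given a uniformizer, every nonzero fraction is a
    unit of [R] times a unique integral power of [t], and that exponent is the
    required valuation ([uniformizer_is_DVR]). *)

(** * Ideals of an integral domain *)

Section Ideals.
Variable R : idomainType.
Implicit Types (I J M : set R) (x y t : R).

Definition principal x : set R := [set y | exists c, y = c * x].

Definition all_ideals_principal : Prop :=
  forall I, is_ideal I -> exists x, I = principal x.

Definition containment_is_division : Prop :=
  forall I J, is_ideal I -> is_ideal J -> J `<=` I -> ideal_dvd I J.

Lemma principal_ideal x : is_ideal (principal x).
Proof.
split=> [|_ _ [c ->] [d ->]|a _ [c ->]].
- by exists 0; rewrite mul0r.
- by exists (c + d); rewrite mulrDl.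
- by exists (a * c); rewrite mulrA.
Qed.

Lemma principal_self x : principal x x.
Proof. by exists 1; rewrite mul1r. Qed.

Lemma principal_sub I x : is_ideal I -> I x -> principal x `<=` I.
Proof. by move=> [_ _ IM] Ix _ [c ->]; exact: IM. Qed.

Lemma ideal_sum I n (a : 'I_n -> R) :
  is_ideal I -> (forall i, I (a i)) -> I (\sum_(i < n) a i).
Proof. by move=> [I0 ID _] Ia; elim/big_ind: _ => // i _; exact: Ia. Qed.

Lemma ideal_unit I x : is_ideal I -> I x -> x \is a GRing.unit -> I = setT.
Proof.
move=> [_ _ IM] Ix Ux; apply/seteqP; split=> // y _.
by rewrite -[y](mulrVK Ux); exact: IM.
Qed.

(** The cofactor of [(x)] in [J] is the quotient ideal of all [r] with
    [x * r] in [J]. *)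
Lemma principal_dvd x J :
  is_ideal J -> J `<=` principal x -> ideal_dvd (principal x) J.
Proof.
move=> idJ sJx; have [J0 JD JM] := idJ.
exists [set r | J (x * r)]; split.
  split=> [|a b|a b] /=; first by rewrite mulr0.
  - by rewrite mulrDr; exact: JD.
  - by rewrite mulrCA; exact: JM.
apply/seteqP; split=> [_ [n [a [b [xa Jb ->]]]]|y Jy].
  apply: ideal_sum => // i; have [c ->] := xa i.
  by rewrite -mulrA; apply: JM; exact: Jb.
have [c yE] := sJx _ Jy.
exists 1, (fun=> x), (fun=> c); split=> [_|_|].
- exact: principal_self.
- by rewrite /= mulrC -yE.
- by rewrite big_ord1 yE mulrC.
Qed.

(** Krull's theorem, by Zorn's lemma. The poset has to contain the union of the
    empty chain, so the empty set is added to the proper ideals above [J]. *)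
Lemma proper_ideal_sub_maximal J :
  is_ideal J -> J <> setT -> exists2 M, maximal_ideal M & J `<=` M.
Proof.
move=> idJ JT.
have ideal1 I : is_ideal I -> I <> setT -> ~ I 1.
  by move=> idI IT I1; apply: IT; apply: (ideal_unit idI I1); exact: unitr1.
pose P (A : set R) := [/\ ~ A 1, forall x y, A x -> A y -> A (x + y),
  forall a x, A x -> A (a * x) & A !=set0 -> J `<=` A].
have PJ : P J.
  by have [J0 JD JM] := idJ; split=> // [|_ x //]; exact: ideal1 idJ JT.
have [F sFP chF|A [PA maxA]] := @Zorn_bigcup R P.
  split.
  - by move=> [X FX X1]; have [/(_ X1)] := sFP _ FX.
  - move=> x y [X FX Xx] [Y FY Yy].
    case: (chF X Y FX FY) => [sXY|sYX].
    + by exists Y => //; have [_ YD _ _] := sFP _ FY; exact: YD (sXY _ Xx) Yy.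
    + by exists X => //; have [_ XD _ _] := sFP _ FX; exact: XD Xx (sYX _ Yy).
  - move=> a x [X FX Xx]; exists X => //.
    by have [_ _ XM _] := sFP _ FX; exact: XM.
  - move=> [x [X FX Xx]] y Jy; exists X => //.
    by have [_ _ _ sJX] := sFP _ FX; apply: sJX => //; exists x.
have [A1 AD AM AJ] := PA.
have J0 : J 0 by case: idJ.
have sJA : J `<=` A.
  have [/AJ//|A0] := pselect (A !=set0).
  exfalso; apply: (maxA J) => //; split=> [x Ax|sJA].
  - by case: A0; exists x.
  - by apply: A0; exists 0; exact: sJA.
exists A => //; split=> [||I idI sAI].
- by split=> //; exact: sJA.
- by move=> AT; apply: A1; rewrite AT.
- have [IT|IT] := pselect (I = setT); first by right.
  left; apply: contrapT => IA; apply: (maxA I).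
    by split=> // sIA; apply: IA; apply/seteqP.
  have [I0 ID IM] := idI.
  by split=> //; [exact: ideal1 idI IT|move=> _ x /sJA /sAI].
Qed.

(** A nonzero maximal ideal excludes [0] from being maximal, so uniqueness among
    the nonzero maximal ideals is uniqueness among all of them. *)
Lemma unique_maximal_nonunits M :
  unique (fun N : set R => maximal_ideal N /\ N <> [set 0]) M ->
  forall x, M x <-> x \isn't a GRing.unit.
Proof.
move=> [[[idM MT maxM] M0] uniqM] x; split=> [Mx|Ux].
  by apply/negP => Ux; apply: MT; exact: ideal_unit Mx Ux.
have [|N maxN sxN] := proper_ideal_sub_maximal (principal_ideal x).
  move=> xT; have : principal x 1 by rewrite xT.
  by move=> [c] /esym cx1; case/negP: Ux; apply/unitrPr; exists c; rewrite mulrC.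
suff -> : M = N by apply: sxN; exact: principal_self.
apply: uniqM; split=> // N0.
have [idN _ /(_ M idM)] := maxN.
by rewrite N0 => -[_ ->|/M0|/MT] //; case: idM.
Qed.

(** In a local domain an invertible ideal is principal: among the [x_i * y_i]
    that sum to [a], one is associate to [a], and its factor [x_i] is a
    generator. *)
Lemma local_dvd_principal M :
  is_ideal M -> (forall x, M x <-> x \isn't a GRing.unit) ->
  containment_is_division -> all_ideals_principal.
Proof.
move=> idM Mnu dvdR I idI.
have [[a Ia a0]|I0] := pselect (exists2 a, I a & a != 0); last first.
  exists 0; apply/seteqP; split=> [x Ix|_ [c ->]].
    exists 0; rewrite mulr0; apply: contrapT => x0.
    by apply: I0; exists x => //; apply/eqP.
  by rewrite mulr0; case: idI.
have [I' [idI' II']] := dvdR _ _ idI (principal_ideal a) (principal_sub idI Ia).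
have mulI x y : I x -> I' y -> principal a (x * y).
  move=> Ix I'y; rewrite -II'.
  by exists 1, (fun=> x), (fun=> y); split=> //; rewrite big_ord1.
have [n [x [y [Ix I'y aE]]]] : ideal_mul I I' a.
  by rewrite II'; exact: principal_self.
have [u uE] := choice (fun i => mulI _ _ (Ix i) (I'y i)).
have sum_u : \sum_(i < n) u i = 1.
  apply: (mulIf a0); rewrite mul1r mulr_suml {2}aE.
  by apply: eq_bigr => i _; rewrite uE.
have [i Ui] : exists i, u i \is a GRing.unit.
  apply: contrapT => nU; suff /Mnu : M 1 by rewrite unitr1.
  rewrite -sum_u; apply: ideal_sum => // i.
  by apply/Mnu/negP => Ui; apply: nU; exists i.
have y0 : y i != 0.
  apply/eqP => y0; move: (uE i); rewrite y0 mulr0 => /esym/eqP.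
  by rewrite mulf_eq0 (negbTE a0) orbF => /eqP u0; move: Ui; rewrite u0 unitr0.
exists (x i); apply/seteqP; split; last exact: principal_sub.
move=> z Iz; have [c zyE] := mulI _ _ Iz (I'y i).
exists (c / u i); apply: (mulIf y0).
by rewrite -mulrA uE zyE mulrA mulrVK.
Qed.

(** * Uniformizers *)

Definition uniformizer t : Prop :=
  [/\ t != 0, t \isn't a GRing.unit
    & forall x, x != 0 ->
        exists u n, u \is a GRing.unit /\ x = u * t ^+ n].

(** The point is that [s], a generator of the intersection of all [(t ^+ n)], is
    zero: [s / t] lies in that intersection too, so [s] is a multiple of
    [t * s], which forces [s = 0] because [t] is not a unit. *)
Lemma local_pid_uniformizer M :
  is_ideal M -> M <> [set 0] -> (forall x, M x <-> x \isn't a GRing.unit) ->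
  all_ideals_principal -> exists t, uniformizer t.
Proof.
move=> idM M0 Mnu pidR; have [t ME] := pidR M idM.
have t0 : t != 0.
  apply/eqP => t0; apply: M0; rewrite ME t0; apply/seteqP; split=> x.
    by move=> [c ->]; rewrite mulr0.
  by move=> ->; exists 0; rewrite mulr0.
have Ut : t \isn't a GRing.unit by apply/Mnu; rewrite ME; exact: principal_self.
exists t; split=> // x x0.
pose D : set R := [set y | forall n, principal (t ^+ n) y].
have idD : is_ideal D.
  split=> [n|y z Dy Dz n|a y Dy n]; have [P0 PD PM] := principal_ideal (t ^+ n).
  - exact: P0.
  - exact: PD.
  - exact: PM.
have [s DE] := pidR D idD.
have Ds : D s by rewrite DE; exact: principal_self.
have s0 : s = 0.
  have [s' sE] := Ds 1; rewrite expr1 in sE.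
  have : D s'.
    move=> n; have [c] := Ds n.+1; rewrite sE exprSr mulrA => /(mulIf t0) ->.
    by exists c.
  rewrite DE => -[d s'E]; apply/eqP; apply: contraNT Ut => s_neq0.
  apply/unitrPr; exists d; apply: (mulIf s_neq0).
  by rewrite mul1r -mulrA -s'E mulrC -sE.
have [n nxn] : exists n, ~ principal (t ^+ n) x.
  apply: contrapT => all_n; case/eqP: x0.
  suff : D x by rewrite DE s0 => -[c ->]; rewrite mulr0.
  by move=> n; apply: contrapT => nxn; apply: all_n; exists n.
(* The last power of [t] that divides [x] leaves a cofactor outside [M]. *)
elim: n nxn => [|n IHn] nxn; first by case: nxn; exists x; rewrite expr0 mulr1.
have [[u xE]|/IHn//] := pselect (principal (t ^+ n) x).
exists u, n; split=> //; apply: contrapT => /negP/Mnu; rewrite ME => -[c uE].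
by apply: nxn; exists c; rewrite xE uE exprS mulrA.
Qed.

Section Uniformizer.
Variables (t : R) (unif_t : uniformizer t).

Lemma uniformizer_principal : all_ideals_principal.
Proof.
move=> I idI; have [_ _ factor] := unif_t; have [I0 _ IM] := idI.
have powI x : I x -> x != 0 ->
    exists u n, [/\ x = u * t ^+ n & I (t ^+ n)].
  move=> Ix /factor[u [n [Uu xE]]]; exists u, n; split=> //.
  by rewrite -[t ^+ n](mulKr Uu) -xE; exact: IM.
have [exI|noI] := pselect (exists n, `[< I (t ^+ n) >]); last first.
  exists 0; apply/seteqP; split=> [x Ix|_ [c ->]]; last by rewrite mulr0.
  exists 0; rewrite mulr0; apply: contrapT => /eqP x0.
  by have [u [n [_ In]]] := powI x Ix x0; apply: noI; exists n; apply/asboolP.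
case: (ex_minnP exI) => n /asboolP In min_n.
exists (t ^+ n); apply/seteqP; split; last exact: principal_sub.
move=> x Ix; have [->|x0] := eqVneq x 0; first by exists 0; rewrite mul0r.
have [u [m [-> Im]]] := powI x Ix x0.
have le_nm : (n <= m)%N by apply: min_n; apply/asboolP.
by exists (u * t ^+ (m - n)); rewrite -mulrA -exprD subnK.
Qed.

Lemma uniformizer_unit_or_dvd x : ~ principal t x -> x \is a GRing.unit.
Proof.
have [_ _ factor] := unif_t => ntx.
have [x0|/factor[u [[|n] [Uu xE]]]] := eqVneq x 0.
- by case: ntx; exists 0; rewrite x0 mul0r.
- by rewrite xE expr0 mulr1.
- by case: ntx; exists (u * t ^+ n); rewrite xE exprSr mulrA.
Qed.

Lemma uniformizer_unique_maximal :
  exists! M : set R, maximal_ideal M /\ M <> [set 0].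
Proof.
have [t0 Ut _] := unif_t.
have idt := principal_ideal t.
have properS (I : set R) : is_ideal I -> I <> setT -> I `<=` principal t.
  move=> idI IT x Ix; apply: contrapT => /uniformizer_unit_or_dvd Ux.
  by apply: IT; exact: ideal_unit Ix Ux.
have tT : principal t <> setT.
  move=> tT; have : principal t 1 by rewrite tT.
  by move=> [c] /esym ct1; case/negP: Ut; apply/unitrPr; exists c; rewrite mulrC.
exists (principal t); split=> [|M [[idM MT maxM] _]]; last first.
  by have [->|/tT] := maxM _ idt (properS _ idM MT).
split; last first.
  move=> tE; have : principal t t by exact: principal_self.
  by rewrite tE => /eqP; rewrite (negbTE t0).
split=> // I idI stI.
have [->|IT] := pselect (I = setT); [by right|left].
by apply/seteqP; split=> //; exact: properS.
Qed.

End Uniformizer.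
End Ideals.

(** * Discrete valuations *)

Section DiscreteValuation.
Variables (K : fieldType) (v : K -> int).
Hypothesis dv : discrete_valuation v.

Lemma valuation1 : v 1 = 0.
Proof.
have [vM _ _] := dv.
by have := vM 1 1 (oner_neq0 _) (oner_neq0 _); rewrite mulr1; lia.
Qed.

Lemma valuationV x : x != 0 -> v x^-1 = - v x.
Proof.
have [vM _ _] := dv => x0; have := vM x x^-1 x0.
by rewrite invr_eq0 x0 divff // valuation1 => /(_ isT); lia.
Qed.

Lemma valuationX x n : x != 0 -> v (x ^+ n) = v x *+ n.
Proof.
have [vM _ _] := dv => x0; elim: n => [|n IHn]; first by rewrite valuation1.
by rewrite exprS vM ?expf_neq0 // IHn mulrS.
Qed.

End DiscreteValuation.

Lemma DVR_uniformizer (R : idomainType) :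
  is_DVR R -> exists t : R, uniformizer t.
Proof.
move=> [K [v [f [dv injf fE]]]].
have [vM v_surj _] := dv.
have f_eq0 x : (f x == 0) = (x == 0).
  by rewrite -(inj_eq injf) rmorph0.
have f_ge0 x : x != 0 -> 0 <= v (f x).
  rewrite -f_eq0 => fx0; have : range f (f x) by exists x.
  by rewrite fE => -[/eqP|//]; rewrite (negbTE fx0).
have f_lift y : 0 <= v y -> exists x, f x = y.
  move=> vy; have : valuation_ring v y by right.
  by rewrite -fE => -[x _ <-]; exists x.
have f_unit y : y != 0 -> v y = 0 -> exists2 u, u \is a GRing.unit & f u = y.
  move=> y0 vy; have [|u uE] := f_lift y; first by rewrite vy.
  have [|w wE] := f_lift y^-1; first by rewrite (valuationV dv) // vy.
  exists u => //; apply/unitrPr; exists w; apply: injf.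
  by rewrite rmorphM uE wE rmorph1 divff.
have [p p0 vp] := v_surj 1.
have [|t tE] := f_lift p; first by rewrite vp.
have t0 : t != 0 by rewrite -f_eq0 tE.
exists t; split=> // [|x x0].
  apply/negP => Ut; have t'0 : t^-1 != 0 by rewrite invr_eq0.
  have := vM (f t) (f t^-1); rewrite !f_eq0 => /(_ t0 t'0).
  rewrite -rmorphM divrr // rmorph1 (valuation1 dv) tE vp.
  by have := f_ge0 _ t'0; lia.
have [n nE] : exists n : nat, v (f x) = n%:Z.
  by exists `|v (f x)|%N; rewrite gez0_abs // f_ge0.
have pn0 : p ^+ n != 0 by rewrite expf_neq0.
have [| |u Uu uE] := f_unit (f x / p ^+ n).
- by rewrite mulf_neq0 ?f_eq0 ?invr_eq0.
- rewrite vM ?f_eq0 ?invr_eq0 // (valuationV dv) // (valuationX dv) // vp nE.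
  by rewrite natz subrr.
exists u, n; split=> //; apply: injf.
by rewrite rmorphM rmorphXn uE tE divfK.
Qed.

(** * The valuation attached to a uniformizer *)

Section UniformizerValuation.
Variables (R : idomainType) (t : R).
Hypothesis unif_t : uniformizer t.
Let K := {fraction R}.
Let T : K := tofrac t.

(** Graph of the valuation of the fraction field. *)
Let order_is (q : K) (n : int) : Prop :=
  exists2 u : R, u \is a GRing.unit & q = tofrac u * T ^ n.

Lemma unit_frac_neq0 (u : R) : u \is a GRing.unit -> tofrac u != 0.
Proof. by rewrite tofrac_eq0; apply: contraTneq => ->; rewrite unitr0. Qed.

Lemma uniformizer_frac_neq0 : T != 0.
Proof. by have [t0 _ _] := unif_t; rewrite tofrac_eq0. Qed.

Lemma order_is_ring (x : R) : x != 0 -> exists n : nat, order_is (tofrac x) n.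
Proof.
have [_ _ factor] := unif_t => /factor[u [n [Uu ->]]].
by exists n, u => //; rewrite rmorphM rmorphXn.
Qed.

Lemma order_is_neq0 q n : order_is q n -> q != 0.
Proof.
move=> [u Uu ->].
by rewrite mulf_neq0 ?unit_frac_neq0 ?expfz_neq0 ?uniformizer_frac_neq0.
Qed.

Lemma order_isM q q' n n' :
  order_is q n -> order_is q' n' -> order_is (q * q') (n + n').
Proof.
move=> [u Uu ->] [u' Uu' ->]; exists (u * u'); first by rewrite unitrM Uu.
by rewrite rmorphM expfzDr ?uniformizer_frac_neq0 // mulrACA.
Qed.

Lemma order_isV q n : order_is q n -> order_is q^-1 (- n).
Proof.
move=> [u Uu ->]; exists u^-1; first by rewrite unitrV.
rewrite invfM invr_expz; congr (_ * _).
apply: (mulfI (unit_frac_neq0 Uu)).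
by rewrite divff ?unit_frac_neq0 // -rmorphM divrr // rmorph1.
Qed.

Lemma frac_quotient (q : K) :
  exists a b : R, b != 0 /\ q = tofrac a / tofrac b.
Proof.
elim/quotW: q => r; exists \n_r, \d_r; split; first exact: denom_ratioP.
have d0 : tofrac \d_r != 0 by rewrite tofrac_eq0 denom_ratioP.
apply: (mulIf d0); rewrite divfK //.
rewrite -[_ * _]/(FracField.mul _ _) !piE; apply/eqP.
rewrite FracField.equivf_def /equivf /FracField.equivf /FracField.mulf.
by rewrite !numden_Ratio ?mulr1 ?oner_neq0 ?denom_ratioP // mulrC.
Qed.

Lemma order_is_exists q : q != 0 -> exists n, order_is q n.
Proof.
have [a [b [b0 ->]]] := frac_quotient q.
rewrite mulf_eq0 invr_eq0 !tofrac_eq0 (negbTE b0) orbF => a0.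
have [n an] := order_is_ring a0; have [m bm] := order_is_ring b0.
by exists (n%:Z - m%:Z); apply: order_isM an (order_isV bm).
Qed.

(** An element of [R] of negative order would make [t] divide a unit. Applied to
    [1 = q / q] in both directions, this yields uniqueness of the order. *)
Lemma order_is_range q n :
  order_is q n -> (0 <= n) <-> exists x : R, q = tofrac x.
Proof.
have [t0 Ut _] := unif_t.
move=> [u Uu ->]; split=> [|[x qE]].
  case: n => // n _; exists (u * t ^+ n).
  by rewrite rmorphM rmorphXn.
case: n qE => // n; rewrite NegzE -invr_expz => /(congr1 ( *%R^~ (T ^+ n.+1))).
rewrite mulfVK ?expf_neq0 ?uniformizer_frac_neq0 // -rmorphXn -rmorphM.
move=> /eqP; rewrite tofrac_eq exprS mulrCA => /eqP uE.
by move: Uu; rewrite uE unitrM (negbTE Ut).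
Qed.

Lemma order_is_inj q n m : order_is q n -> order_is q m -> n = m.
Proof.
have leq_order n' m' : order_is q n' -> order_is q m' -> m' <= n'.
  move=> qn qm; rewrite -subr_ge0; apply/(order_is_range (order_isM qn (order_isV qm))).
  by exists 1; rewrite divff ?rmorph1 // (order_is_neq0 qn).
by move=> qn qm; apply/eqP; rewrite eq_le !leq_order.
Qed.

(** After dividing by the summand of smaller order, both summands lie in [R]. *)
Lemma order_isD q q' n n' m :
  order_is q n -> order_is q' n' -> order_is (q + q') m -> Num.min n n' <= m.
Proof.
wlog le_nn' : q q' n n' / n <= n' => [hw qn qn' qm|qn qn' qm].
  have [le_nn'|lt_n'n] := leP n n'.
    by have := hw _ _ _ _ le_nn' qn qn' qm; rewrite min_l.
  have := hw q' q n' n (ltW lt_n'n) qn' qn; rewrite addrC => /(_ qm).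
  by rewrite min_l // ltW.
rewrite min_l // -subr_ge0.
apply/(order_is_range (order_isM qm (order_isV qn))).
have [x' q'E] : exists x', q' / q = tofrac x'.
  by apply/(order_is_range (order_isM qn' (order_isV qn))); rewrite subr_ge0.
exists (1 + x').
by rewrite mulrDl divff ?(order_is_neq0 qn) // q'E rmorphD rmorph1.
Qed.

Lemma uniformizer_is_DVR : is_DVR R.
Proof.
have /choice[v vP] : forall q : K, exists n, q != 0 -> order_is q n.
  move=> q; have [->|/order_is_exists[n qn]] := eqVneq q 0; first by exists 0.
  by exists n.
exists K, v, (@tofrac R); split.
- split=> [x y x0 y0|n|x y x0 y0 xy0].
  + apply: order_is_inj (order_isM (vP _ x0) (vP _ y0)).
    by apply: vP; rewrite mulf_neq0.
  + have T0 := expfz_neq0 n uniformizer_frac_neq0.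
    exists (T ^ n) => //; apply: order_is_inj (vP _ T0) _.
    by exists 1; rewrite ?unitr1 // rmorph1 mul1r.
  + exact: order_isD (vP _ x0) (vP _ y0) (vP _ xy0).
- by move=> x y /eqP; rewrite tofrac_eq => /eqP.
- apply/seteqP; split=> [_ [x _ <-]|q].
    have [x0|x0] := eqVneq (tofrac x) 0; [by left|right].
    by apply/(order_is_range (vP _ x0)); exists x.
  have [->|q0] := eqVneq q 0; first by exists 0; rewrite ?rmorph0.
  move=> [/eqP|/(order_is_range (vP _ q0))[x ->]]; last by exists x.
  by rewrite (negbTE q0).
Qed.

End UniformizerValuation.

Theorem theorem19 (R : idomainType) :
  is_DVR R <->
  (exists! M : set R, maximal_ideal M /\ M <> [set 0]) /\
  (forall I J : set R, is_ideal I -> is_ideal J -> J `<=` I -> ideal_dvd I J).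
Proof.
split=> [/DVR_uniformizer[t unif_t]|[[M uniqM] dvdR]].
  split=> [|I J idI idJ]; first exact: uniformizer_unique_maximal unif_t.
  have [x ->] := uniformizer_principal unif_t idI.
  exact: principal_dvd.
have Mnu := unique_maximal_nonunits uniqM.
have [[[idM _ _] M0] _] := uniqM.
have pidR := local_dvd_principal idM Mnu dvdR.
have [t unif_t] := local_pid_uniformizer idM M0 Mnu pidR.
exact: uniformizer_is_DVR unif_t.
Qed.
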